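(* Let $l,k$ be positive integers and let $G_1,\ldots,G_l$ be $k$-symmetric graphs. Let $G=\overline{K}_k\vee_k(G_1\cup\cdots\cup G_l)$. Then $m_G(1)\ge l-1$.
   Context: A finite simple graph $H$ is $k$-symmetric if $\mathrm{Aut}(H)$ contains a subgroup isomorphic to $\mathbb{Z}_k$ acting freely on $V(H)$; a generator $\varphi$ of such a subgroup is a $k$-symmetric automorphism, and a base of $\varphi$ is a subset $B\subseteq V(H)$ containing exactly one vertex from each $\langle\varphi\rangle$-orbit. The graph $G=\overline{K}_k\vee_k(G_1\cup\cdots\cup G_l)$ is defined as follows, for arbitrary choices of $k$-symmetric automorphisms $\varphi_i$ of $G_i$ and bases $B_i$ of $\varphi_i$: take the disjoint union of $G_1,\ldots,G_l$ together with $k$ new pairwise nonadjacent vertices $u_j$, $j\in\mathbb{Z}_k$, and for each $j\in\mathbb{Z}_k$ and each $i\in\{1,\dots,l\}$ join $u_j$ to every vertex of $\varphi_i^j(B_i)$; no other edges are added (in particular no edges between distinct $G_i$). $m_G(\lambda)$ denotes the multiplicity of $\lambda$ as an eigenvalue of the Laplacian $L(G)=D(G)-A(G)$. *)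

(* Defs.v *)
From HB Require Import structures.
From mathcomp Require Import all_boot all_order all_fingroup all_algebra all_solvable.
Set Implicit Arguments.
Unset Strict Implicit.
Unset Printing Implicit Defensive.

Import GRing.Theory.

Record sgraph := SGraph {
  vertex :> finType;
  adj : rel vertex;
  adj_sym : symmetric adj;
  adj_irrefl : irreflexive adj
}.

Definition graph_aut (H : sgraph) : {set {perm H}} :=
  [set s : {perm H} | [forall x, forall y, adj (s x) (s y) == adj x y]].

(* For k > 0, [Zp k] is the additive group Z/k (the trivial group if k = 1). *)
Definition free_Zk_subgroup (k : nat) (H : sgraph) (K : {group {perm H}}) : Prop :=
  [/\ K \subset graph_aut H, (K \isog Zp k)%g
    & forall x : H, ('C_K[x | 'P] = 1)%g].

Definition k_symmetric (k : nat) (H : sgraph) : Prop :=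
  exists K : {group {perm H}}, free_Zk_subgroup k K.

Definition k_symmetric_aut (k : nat) (H : sgraph) (phi : {perm H}) : Prop :=
  exists2 K : {group {perm H}}, free_Zk_subgroup k K & generator K phi.

Definition is_base (H : sgraph) (phi : {perm H}) (B : {set H}) : Prop :=
  forall O : {set H}, O \in porbits phi -> #|B :&: O| = 1.

Section KJoin.
Variables (k l : nat) (Gs : 'I_l -> sgraph).
Variables (phi : forall i, {perm Gs i}) (B : forall i, {set Gs i}).

(* [inl j] is the new vertex u_j; [inr (Tagged _ v)] is a vertex v of one of
   the Gs i.  The index j in Z/k is given by its representative in
   {0, ..., k - 1}. *)
Definition kjoin_vertex : finType := ('I_k + {i : 'I_l & Gs i})%type.

Definition kjoin_adj : rel kjoin_vertex := fun a b =>
  match a, b with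
  | inl _, inl _ => false
  | inl j, inr v | inr v, inl j =>
      tagged v \in (phi (tag v) ^+ j)%g @: B (tag v)
  | inr v, inr w => (tag v == tag w) && adj (tagged v) (tagged_as v w)
  end.

Lemma kjoin_adj_sym : symmetric kjoin_adj.
Proof.
move=> [j|[i v]] [j'|[i' w]] //=.
case: (eqVneq i i') => [E|//]; subst i'.
by rewrite /= !tagged_asE adj_sym.
Qed.

Lemma kjoin_adj_irrefl : irreflexive kjoin_adj.
Proof. by move=> [j|[i v]] //=; rewrite tagged_asE adj_irrefl andbF. Qed.

Definition kjoin : sgraph := SGraph kjoin_adj_sym kjoin_adj_irrefl.

End KJoin.

Section Laplacian.
Local Open Scope ring_scope.
Variables (R : fieldType) (H : sgraph).

Definition degree (x : H) : nat := #|[set y | adj x y]|.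

Definition degree_mx : 'M[R]_#|H| := diag_mx (\row_i (degree (enum_val i))%:R).

Definition adjacency_mx : 'M[R]_#|H| :=
  \matrix_(i, j) (adj (enum_val i) (enum_val j))%:R.

Definition laplacian : 'M[R]_#|H| := degree_mx - adjacency_mx.

(* The Laplacian is symmetric, so its row and column eigenspaces agree, and
   over a real closed field geometric and algebraic multiplicities coincide. *)
Definition laplacian_mult (lambda : R) : nat :=
  \rank (eigenspace laplacian lambda).

End Laplacian.

(* Main.v *)
(** A function that vanishes on the new vertices [u_j] and is constant, equal to
[c_i], on each [G_i] is an eigenvector for 1 as soon as [\sum_i c_i |B_i| = 0]:
freeness of the action gives each vertex of [G_i] exactly one neighbour among
the [u_j], and each [u_j] has exactly [|B_i|] neighbours in [G_i].  These
functions form a space of dimension at least [l - 1]. *)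
Require Import Defs.
From HB Require Import structures.
From mathcomp Require Import all_boot all_order all_fingroup all_algebra all_solvable.
Set Implicit Arguments.
Unset Strict Implicit.
Unset Printing Implicit Defensive.

Import GRing.Theory.

Lemma k_symmetric_aut_order (k : nat) (H : sgraph) (phi : {perm H}) :
  0 < k -> k_symmetric_aut k phi -> #[phi]%g = k.
Proof.
move=> k_gt0 [K [_ isoK _] /eqP defK].
by rewrite /order -defK (card_isog isoK) card_Zp.
Qed.

(** The quotient of the two powers lies in [K] and fixes [x], so freeness makes it trivial. *)
Lemma k_symmetric_aut_free (k : nat) (H : sgraph) (phi : {perm H}) (x : H) m n :
  k_symmetric_aut k phi ->
  (phi ^+ m)%g x = (phi ^+ n)%g x -> (phi ^+ m = phi ^+ n)%g.
Proof.
move=> [K [_ _ freeK] /eqP defK] eq_mn.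
have Kphi q : (phi ^+ q)%g \in K by rewrite defK mem_cycle.
have : (phi ^+ m * (phi ^+ n)^-1)%g \in ('C_K[x | 'P])%g.
  rewrite inE groupM ?groupV //=; apply/astab1P.
  by rewrite /= /aperm permM eq_mn permK.
by rewrite freeK => /set1P/eqP; rewrite -eq_mulgV1 => /eqP.
Qed.

(** The base meets the orbit of [v] in a single [b], and [v] is the image of [b] under some power
    [n] of [phi]. By freeness that power is determined by [v], so [n] is unique modulo the order
    [k]. *)
Lemma card_base_translates (k : nat) (H : sgraph) (phi : {perm H})
    (B : {set H}) (v : H) :
  0 < k -> k_symmetric_aut k phi -> is_base phi B ->
  #|[set j : 'I_k | v \in (phi ^+ j)%g @: B]| = 1.
Proof.
move=> k_gt0 symphi baseB.
have ordphi := k_symmetric_aut_order k_gt0 symphi.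
have /eqP/cards1P[b defb] : #|B :&: porbit phi v| = 1.
  by apply: baseB; apply: imset_f.
have /setIP[Bb] : b \in B :&: porbit phi v by rewrite defb set11.
rewrite porbit_sym => /porbitP[n def_v].
have lt_nk : n %% k < k by rewrite ltn_mod.
apply/eqP/cards1P; exists (Ordinal lt_nk); apply/setP=> j; rewrite !inE.
apply/imsetP/eqP=> [[b' Bb' def_v'] | ->]; last first.
  by exists b => //=; rewrite -ordphi expg_mod_order.
(* Any other preimage of [v] in the base lies in the orbit of [v], hence is [b] itself. *)
have /set1P eq_b : b' \in [set b].
  by rewrite -defb inE Bb' porbit_sym def_v' mem_porbit.
apply: val_inj => /=; subst b'.
have /eqP := k_symmetric_aut_free symphi (etrans (esym def_v') def_v).
by rewrite eq_expg_mod_order ordphi (modn_small (ltn_ord j)) => /eqP.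
Qed.

Section EigenvalueOne.
Local Open Scope ring_scope.

(** The diagonal term [f a * degree a] is spread over the neighbours of [a]. The product is taken on
    the left because [eigenspace] consists of row vectors. *)
Lemma sum_mul_laplacian (R : fieldType) (H : sgraph) (f : H -> R) (a : 'I_#|H|) :
  \sum_(x < #|H|) f (enum_val x) * laplacian R H x a =
  \sum_(y : H) (f (enum_val a) - f y) * (adj y (enum_val a))%:R.
Proof.
under eq_bigr do rewrite !mxE mulrBr.
rewrite sumrB (bigD1 a) //= eqxx mulr1n big1 ?addr0; last first.
  by move=> x /negPf ->; rewrite mulr0n mulr0.
under [RHS]eq_bigr do rewrite mulrBl.
rewrite sumrB -mulr_sumr; congr (_ * _ - _).
  rewrite /degree -sum1_card natr_sum big_mkcond; apply: eq_bigr => y _.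
  by rewrite inE adj_sym; case: (adj _ _).
by rewrite [RHS]big_enum_val; apply: eq_bigr.
Qed.

Variables (R : fieldType) (k l : nat) (Gs : 'I_l -> sgraph).
Variables (phi : forall i, {perm Gs i}) (B : forall i, {set Gs i}).
Hypotheses (k_gt0 : (0 < k)%N) (phi_ksym : forall i, k_symmetric_aut k (phi i)).
Hypothesis B_base : forall i, is_base (phi i) (B i).

Local Notation G := (kjoin k phi B).

Definition part_ind (i : 'I_l) (x : G) : R :=
  if x is inr v then (tag v == i)%:R else 0.

Definition part_mx : 'M[R]_(l, #|G|) := \matrix_(i, a) part_ind i (enum_val a).

Definition base_card_mx : 'cV[R]_l := \col_i #|B i|%:R.

Definition new_vertex_mx : 'rV[R]_#|G| :=
  \row_a (if enum_val a is inl _ then 1 else 0).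

Lemma laplacian_part_ind (i : 'I_l) (x : G) :
  \sum_(y : G) (part_ind i x - part_ind i y) * (adj y x)%:R =
  part_ind i x - #|B i|%:R * (if x is inl _ then 1 else 0).
Proof.
rewrite big_sumType /=; case: x => [j | v] /=.
  rewrite big1 ?add0r => [|j' _]; last by rewrite mulr0.
  rewrite mulr1 -(card_imset (B i) (@perm_inj _ (phi i ^+ j)%g)).
  rewrite -sum1_card natr_sum -sumrN.
  (* The sum over the tagged vertices becomes a double sum, so that part [i] can be isolated: it
     contributes one [-1] for each element of the translated base. *)
  rewrite -(sig_big_dep xpredT (fun _ _ => true)
    (fun i' v => (0 - (i' == i)%:R) * (v \in (phi i' ^+ j)%g @: B i')%:R)) /=.
  rewrite (bigD1 i) //= [X in _ + X]big1 ?addr0 => [|i' /negPf neq_i'].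
    rewrite [RHS]big_mkcond; apply: eq_bigr => v _.
    by rewrite eqxx sub0r mulN1r; case: (v \in _); rewrite ?oppr0.
  by apply: big1 => v _; rewrite neq_i' subrr mul0r.
(* At an old vertex, neighbours in its own part carry the same value and other parts are not
   adjacent; what remains is its unique new neighbour, where the indicator is 0. *)
rewrite [X in _ + X]big1 => [|w _]; last first.
  have [eq_wv | _] := eqVneq (tag w) (tag v); last by rewrite mulr0.
  by rewrite {1}eq_wv subrr mul0r.
rewrite addr0 -mulr_sumr !subr0 mulr0 subr0 -natr_sum.
have := card_base_translates (tagged v) k_gt0 (phi_ksym _) (@B_base (tag v)).
rewrite -sum1_card big_mkcond /= => card1.
rewrite (eq_bigr (fun j : 'I_k => if j \in [set j : 'I_k |
    tagged v \in (phi (tag v) ^+ j)%g @: B (tag v)] then 1%N else 0%N)).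
  by rewrite card1 mulr1.
by move=> j _; rewrite inE; case: (_ \in _).
Qed.

(** The defect of the part indicators from being eigenvectors for 1 factors through the single
    column [base_card_mx], so every combination killed by that column is an eigenvector or zero. *)
Lemma part_mx_laplacian :
  part_mx *m (laplacian R G - 1%:M) = - (base_card_mx *m new_vertex_mx).
Proof.
apply/matrixP=> i a; rewrite mulmxBr mulmx1 !mxE.
under eq_bigr do rewrite mxE.
rewrite sum_mul_laplacian laplacian_part_ind big_ord1 !mxE.
by rewrite addrAC subrr add0r.
Qed.

Lemma part_mx_row_free : (forall i, 0 < #|Gs i|)%N -> row_free part_mx.
Proof.
move=> Gs_gt0.
have pick_part i : Gs i.
  by case: (pickP (Gs i)) (Gs_gt0 i) => [v _ _ | /eq_card0 ->].
(* Restricting [part_mx] to one representative column per part gives the identity; the selection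
   matrix is thus a right inverse. *)
pose rep i : G := inr (Tagged (fun i => vertex (Gs i)) (pick_part i)).
apply/row_freeP; exists (\matrix_(a, i) (enum_val a == rep i)%:R).
apply/matrixP=> i i'; rewrite !mxE (bigD1 (enum_rank (rep i'))) //= big1.
  by rewrite !mxE enum_rankK eqxx mulr1 addr0 /= eq_sym.
move=> a neq_a; rewrite !mxE; case: eqP => [eq_a | _]; last by rewrite mulr0.
by rewrite -eq_a enum_valK eqxx in neq_a.
Qed.

Lemma laplacian_mult1_kjoin :
  (forall i, 0 < #|Gs i|)%N -> (l - 1 <= laplacian_mult G (1 : R))%N.
Proof.
move=> Gs_gt0.
have /mxrankS : (kermx base_card_mx *m part_mx <= eigenspace (laplacian R G) 1)%MS.
  apply/sub_kermxP.
  by rewrite -mulmxA part_mx_laplacian mulmxN mulmxA mulmx_ker mul0mx oppr0.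
(* Multiplying by the row-free [part_mx] preserves the rank of the kernel, which is [l] minus the
   rank, at most 1, of a single column. *)
apply: leq_trans; rewrite mxrankMfree ?part_mx_row_free // mxrank_ker.
by rewrite leq_sub2l // rank_leq_col.
Qed.

End EigenvalueOne.

Theorem theorem4p5 (R : rcfType) (l k : nat) (l_gt0 : 0 < l) (k_gt0 : 0 < k)
    (Gs : 'I_l -> sgraph)
    (Gs_nonempty : forall i, 0 < #|Gs i|)
    (Gs_ksym : forall i, k_symmetric k (Gs i))
    (phi : forall i, {perm Gs i})
    (phi_ksym : forall i, k_symmetric_aut k (phi i))
    (B : forall i, {set Gs i})
    (B_base : forall i, is_base (phi i) (B i)) :
  l - 1 <= laplacian_mult (kjoin k phi B) (1%R : R).
Proof. exact: laplacian_mult1_kjoin. Qed.
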